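(* Let $A_1=10001$, $B_1=10101$, $C_1=10100$, and for all $n\ge1$ define $A_{n+1}=A_nA_nB_nB_n$, $B_{n+1}=A_nB_nC_nB_n$, $C_{n+1}=A_nB_nC_nC_n$. Let $A=\lim_{n\to\infty}A_n$. The unimodal map $f$ with kneading sequence $A$ has regularly recurrent turning point $c$, $f|_{\omega(c)}$ is a minimal homeomorphism, and the map admits no embedded odometer (i.e. $f|_{\omega(c)}$ is not conjugate to an odometer).
   Context: A unimodal map is a continuous $f:[0,1]\to[0,1]$ with turning point $c\in(0,1)$, strictly increasing on $[0,c]$ and strictly decreasing on $[c,1]$; it is assumed to have no periodic attractor and to satisfy the contraction principle (for every $\varepsilon>0$ there is $\delta>0$ with $|f^n(J)|>\delta$ for all $n>0$ and all intervals $J$ with $|J|>\varepsilon$). $c_i=f^i(c)$; the kneading sequence is $\mathcal K(f)=e_1e_2\cdots$ with $e_i=1$ if $c_i>c$, $e_i=0$ if $c_i<c$. $A_n$ is a prefix of $A_{n+1}$, so $A$ is a well-defined infinite $0$-$1$ sequence. The sequence $A$ is shift-maximal in the parity-lexicographic order, hence is realized as the kneading sequence of a unimodal map, unique up to topological conjugacy. A point $x$ is regularly recurrent if for every open $U\ni x$ there is $M\in\mathbb N$ with $f^{Mj}(x)\in U$ for all $j\in\mathbb N$. For a sequence $\alpha=(j_1,j_2,\dots)$ of integers $\ge2$, the $\alpha$-adic odometer is the map $x\mapsto x+(1,0,0,\dots)$ on $\prod_{i\ge1}\{0,\dots,j_i-1\}$ with addition modulo $j_i$ with carry to the right. *)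

(* Defs.v *)
From HB Require Import structures.
From mathcomp Require Import all_boot all_order all_algebra.
From mathcomp Require Import all_classical all_reals all_analysis.
Import Order.TTheory GRing.Theory Num.Theory.
Import numFieldNormedType.Exports.

Set Implicit Arguments.
Unset Strict Implicit.
Unset Printing Implicit Defensive.

Local Open Scope classical_set_scope.
Local Open Scope ring_scope.

Section TopologicalDynamics.
Context {X Y : topologicalType}.

Definition orbit_set (f : X -> X) (x : X) : set X :=
  [set iter n f x | n in [set: nat]].

Definition omega_limit (f : X -> X) (x : X) : set X :=
  cluster ((fun n => iter n f x) @ \oo).

(* The period [M] has to be positive: [M = 0] would always do. *)
Definition regularly_recurrent (f : X -> X) (x : X) : Prop :=
  forall U : set X, open U -> U x ->
    exists2 M : nat, (0 < M)%N & forall j : nat, U (iter (M * j)%N f x).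

(* [h] restricts to a homeomorphism from [A] onto [B], both with the
   subspace topology; the values of [h] off [A] are irrelevant. *)
Definition homeomorphism_on (A : set X) (B : set Y) (h : X -> Y) : Prop :=
  {within A, continuous h} /\
  exists g : Y -> X,
    [/\ set_fun A B h, set_fun B A g, {in A, cancel h g}, {in B, cancel g h}
      & {within B, continuous g}].

Definition minimal_on (f : X -> X) (A : set X) : Prop :=
  set_fun A A f /\ forall x, A x -> A `<=` closure (orbit_set f x).

Definition conjugate_on (f : X -> X) (A : set X) (g : Y -> Y) (B : set Y) :
    Prop :=
  exists2 h : X -> Y, homeomorphism_on A B h &
    forall x, A x -> h (f x) = g (h x).

End TopologicalDynamics.

(* [alpha i] stands for j_(i+1). *)
Definition odometer_space (alpha : nat -> nat) : topologicalType :=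
  prod_topology (fun i : nat => discrete_topology 'I_(alpha i)).

(* The carry entering coordinate [n] when (1,0,0,...) is added to [x]; the
   initial carry 1 into coordinate 0 is the summand itself. *)
Fixpoint odometer_carry (alpha : nat -> nat) (x : forall i, 'I_(alpha i))
    (n : nat) : bool :=
  if n is m.+1 then (alpha m <= x m + odometer_carry x m)%N else true.

Definition odometer (alpha : nat -> nat) (x : odometer_space alpha) :
    odometer_space alpha :=
  fun i => Ordinal (ltn_pmod (x i + odometer_carry x i)
                      (leq_ltn_trans (leq0n (x i)) (ltn_ord (x i)))).

Section Unimodal.
Context {R : realType}.

Definition attracting_periodic_orbit (f : R -> R) (p : R) : Prop :=
  (exists2 n : nat, (0 < n)%N & iter n f p = p) /\
  exists a b : R, [/\ 0 <= a, a < b, b <= 1 &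
    forall x, a < x < b -> omega_limit f x = orbit_set f p].

(* The length of an interval contained in [0,1]; it is 0 for the empty set,
   since [sup set0 = inf set0 = 0]. *)
Definition itv_length (J : set R) : R := sup J - inf J.

Definition contraction_principle (f : R -> R) : Prop :=
  forall eps : R, 0 < eps -> exists2 delta : R, 0 < delta &
    forall J : set R, is_interval J -> J `<=` `[0, 1] ->
      eps < itv_length J ->
      forall n : nat, (0 < n)%N -> delta < itv_length (iter n f @` J).

(* A self-map of [0,1] is represented by a function on [R] preserving [0,1];
   its values outside [0,1] play no role. *)
Record unimodal (f : R -> R) (c : R) : Prop := Unimodal {
  unimodal_maps : set_fun `[0, 1] `[0, 1] f;
  unimodal_cont : {within `[0, 1], continuous f};
  unimodal_turning : 0 < c < 1;
  unimodal_incr : {in `[0, c] &, {homo f : x y / x < y}};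
  unimodal_decr : {in `[c, 1] &, {homo f : x y / x < y >-> y < x}};
  unimodal_no_attractor :
    forall p : R, 0 <= p <= 1 -> ~ attracting_periodic_orbit f p;
  unimodal_contraction : contraction_principle f }.

(* [e i] stands for the letter e_(i+1), with [true] for 1. *)
Definition kneading_sequence (f : R -> R) (c : R) (e : nat -> bool) : Prop :=
  forall i : nat, if e i then c < iter i.+1 f c else iter i.+1 f c < c.

End Unimodal.

(* [blocks n] is (A_(n+1), B_(n+1), C_(n+1)). *)
Fixpoint blocks (n : nat) : seq bool * seq bool * seq bool :=
  if n is m.+1 then
    let: (A, B, C) := blocks m in
    (A ++ A ++ B ++ B, A ++ B ++ C ++ B, A ++ B ++ C ++ C)
  else ([:: true; false; false; false; true],
        [:: true; false; true; false; true],
        [:: true; false; true; false; false]).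

Definition blockA (n : nat) : seq bool := (blocks n).1.1.

(* The limit A of the prefix chain A_1, A_2, ...; as |A_(i+1)| = 5 * 4^i > i,
   letter number [i] can be read off from [blockA i]. *)
Definition seqA (i : nat) : bool := nth false (blockA i) i.

Lemma size_blocks n :
  [/\ size (blocks n).1.1 = (5 * 4 ^ n)%N, size (blocks n).1.2 = (5 * 4 ^ n)%N
    & size (blocks n).2 = (5 * 4 ^ n)%N].
Proof.
elim: n => // n; rewrite /=; case: (blocks n) => [[A B] C] /= [sA sB sC].
have e : (5 * 4 ^ n.+1 = 5 * 4 ^ n + (5 * 4 ^ n + (5 * 4 ^ n + 5 * 4 ^ n)))%N.
  by rewrite expnS mulnCA; set k := (5 * 4 ^ n)%N; rewrite !mulSn addn0.
by rewrite !size_cat sA sB sC e.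
Qed.

Lemma size_blockA n : size (blockA n) = (5 * 4 ^ n)%N.
Proof. by case: (size_blocks n). Qed.

Lemma ltn_size_blockA n : (n < size (blockA n))%N.
Proof.
by rewrite size_blockA (leq_trans (ltn_expl n (isT : 1 < 4)%N)) ?leq_pmull.
Qed.

Lemma prefix_blockA m n : (m <= n)%N -> prefix (blockA m) (blockA n).
Proof.
move=> /subnK <-; elim: (n - m)%N => [|k IH]; first exact: prefix_refl.
apply: (prefix_trans IH); rewrite addSn /blockA /=.
by case: (blocks _) => [[A B] C] /=; exact: prefix_prefix.
Qed.

Lemma seqA_blockA n i : (i < size (blockA n))%N ->
  seqA i = nth false (blockA n) i.
Proof.
move=> lt_in; rewrite /seqA; case: (leqP n i) => [le|/ltnW le].
  by have /prefixP[s ->] := prefix_blockA le; rewrite nth_cat lt_in.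
have /prefixP[s ->] := prefix_blockA le.
by rewrite nth_cat ltn_size_blockA.
Qed.

(* Main.v *)
(* A is the image of the fixed point of a -> aabb, b -> abcb, c -> abcc under
   the coding by blocks of length 5 * 4^n, written [blen n].  By contraction,
   two distinct points cannot share an itinerary that is not eventually
   periodic; as all blocks of level n + 1 start with A_n, the times divisible
   by [blen n] bring c back close to itself, and conversely close returns
   happen only at multiples of [blen n], because A_n marks the block
   boundaries.  This gives regular recurrence, hence minimality, and the visit
   times to a neighbourhood of a point of omega(c) have a well-defined residue
   modulo [blen n].  Two points x < c < y of omega(c) with a common image z
   would have the same residues; since B_n and C_n differ only in their last
   letters, z would hit c twice, which is impossible.  Finally, the times
   5 * (1...1) and 5 * (21...1), in base 4, have the same residues but
   accumulate at different points, whereas a conjugacy to an odometer would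
   separate points only by residues. *)

Require Import Defs.
From mathcomp Require Import all_boot all_order all_algebra.
From mathcomp Require Import all_classical all_reals all_analysis.
From mathcomp Require Import lra zify.
Import Order.TTheory GRing.Theory Num.Theory.
Import numFieldNormedType.Exports.

Set Implicit Arguments.
Unset Strict Implicit.
Unset Printing Implicit Defensive.

Local Open Scope classical_set_scope.
Local Open Scope ring_scope.

(** * The substitution, its fixed word and the combinatorics of A *)

Section Substitution.
Local Open Scope nat_scope.

Definition blen (n : nat) : nat := 5 * 4 ^ n.

Lemma blen_gt0 n : 0 < blen n.
Proof. by rewrite muln_gt0 expn_gt0. Qed.

Lemma blenS n : blen n.+1 = 4 * blen n.
Proof. by rewrite /blen expnS mulnCA. Qed.

Lemma dvdn_blen m n : m <= n -> blen m %| blen n.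
Proof. by move=> le; rewrite dvdn_pmul2l // dvdn_exp2l. Qed.

Lemma ltn_blen n : n < blen n.
Proof. by rewrite (leq_trans (ltn_expl n (isT : 1 < 4))) // leq_pmull. Qed.

Inductive letter : Set := La | Lb | Lc.

Definition subst_letter (x : letter) : seq letter :=
  match x with
  | La => [:: La; La; Lb; Lb]
  | Lb => [:: La; Lb; Lc; Lb]
  | Lc => [:: La; Lb; Lc; Lc]
  end.

Definition block (n : nat) (x : letter) : seq bool :=
  match x with
  | La => (blocks n).1.1
  | Lb => (blocks n).1.2
  | Lc => (blocks n).2
  end.

Lemma size_block n x : size (block n x) = blen n.
Proof. by have [] := size_blocks n; case: x. Qed.

Lemma blockS n x : block n.+1 x = flatten (map (block n) (subst_letter x)).
Proof.
by rewrite /block /=; case: (blocks n) => [[A B] C]; case: x; rewrite /= cats0.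
Qed.

Lemma nth_blockS n x r i : r < 4 -> i < blen n ->
  nth false (block n.+1 x) (blen n * r + i) =
  nth false (block n (nth La (subst_letter x) r)) i.
Proof.
move=> r4 ilt; rewrite blockS.
have: r < size (subst_letter x) by case: x {ilt}.
elim: (subst_letter x) r {r4} => //= y s IH [|r] rs.
  by rewrite muln0 add0n nth_cat size_block ilt.
rewrite nth_cat size_block mulnS -addnA ltnNge leq_addr /= addKn.
exact: IH.
Qed.

(* Letter number [u] of the [k]-th iterate of the substitution at [La],
   provided [u < 4 ^ k]. *)
Fixpoint fixword_level (k u : nat) : letter :=
  if k is k'.+1 then nth La (subst_letter (fixword_level k' (u %/ 4))) (u %% 4)
  else La.

(** Level [u] suffices because [u < 4 ^ u], and higher levels give the same letter. *)
Definition fixword (u : nat) : letter := fixword_level u u.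

Lemma fixword_levelS k u : u < 4 ^ k ->
  fixword_level k.+1 u = fixword_level k u.
Proof.
elim: k u => [|k IH] u; first by rewrite expn0 ltnS leqn0 => /eqP ->.
move=> ult; rewrite -[LHS]/(nth La (subst_letter (fixword_level k.+1 (u %/ 4)))
  (u %% 4)) IH // ltn_divLR // mulnC -expnS //.
Qed.

Lemma fixword_levelE k u : u < 4 ^ k -> fixword_level k u = fixword u.
Proof.
have stab j n : u < 4 ^ j -> fixword_level (n + j) u = fixword_level j u.
  move=> ult; elim: n => // n IH; rewrite addSn fixword_levelS ?IH //.
  by rewrite (leq_trans ult) // leq_pexp2l // leq_addl.
move=> ult; rewrite /fixword -(stab _ u ult) addnC stab //.
exact: ltn_expl.
Qed.

Lemma fixwordS u r : r < 4 ->
  fixword (4 * u + r) = nth La (subst_letter (fixword u)) r.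
Proof.
move=> r4; rewrite -(@fixword_levelE u.+1) /=; last first.
  have := ltn_expl u (isT : 1 < 4); rewrite expnS; lia.
by rewrite mulnC divnMDl // divn_small // addn0 modnMDl modn_small.
Qed.

(** The substitution leaves its fixed word unchanged, so the same word spells A in blocks of every
    level. *)
Lemma seqA_fixword n u i : i < blen n ->
  seqA (blen n * u + i) = nth false (block n (fixword u)) i.
Proof.
have level k m v j : v < 4 ^ k -> j < blen m ->
    nth false (block (m + k) La) (blen m * v + j) =
    nth false (block m (fixword_level k v)) j.
  elim: k m v j => [|k IH] m v j.
    by rewrite expn0 ltnS leqn0 => /eqP ->; rewrite muln0 addn0.
  move=> vlt jlt; rewrite /= -nth_blockS ?ltn_mod // -IH.
  - congr nth; first by rewrite addSnnS.
    rewrite {1}(divn_eq v 4) blenS; lia.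
  - by rewrite ltn_divLR // mulnC -expnS.
  - have := ltn_mod v 4; rewrite blenS; nia.
move=> ilt; rewrite (@seqA_blockA (n + u)).
  rewrite -[blockA _]/(block _ La) level ?fixword_levelE //; exact: ltn_expl.
rewrite size_blockA expnD mulnA -/(blen n).
have := ltn_expl u (isT : 1 < 4); nia.
Qed.

(** The images abcb and abcc differ only in their last letter, again b against c, so each level
    pushes the difference to the very end. *)
Lemma block_BC n i : i.+1 != blen n ->
  nth false (block n Lb) i = nth false (block n Lc) i.
Proof.
elim: n i => [|n IH] i; first
  by case: i => [|[|[|[|[|i]]]]] //=; rewrite !nth_nil.
have [ile ine|ilt ine] := leqP (blen n.+1) i.
  by rewrite !nth_default ?size_block.
have r4 : i %/ blen n < 4 by rewrite ltn_divLR ?blen_gt0 // -blenS.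
have jlt : i %% blen n < blen n by rewrite ltn_mod blen_gt0.
rewrite (divn_eq i (blen n)) mulnC !nth_blockS //.
move: ine; rewrite {1}(divn_eq i (blen n)) blenS.
case: (i %/ blen n) r4 => [|[|[|[|//]]]] //= _ ine; apply: IH.
by apply/eqP => e; move/eqP: ine; apply; rewrite -addnS e; lia.
Qed.

Lemma last_block_B n : nth false (block n Lb) (blen n).-1.
Proof.
elim: n => // n IH; have := blen_gt0 n; case E: (blen n) => [//|k] _.
have -> : (blen n.+1).-1 = blen n * 3 + k by rewrite blenS; lia.
by rewrite nth_blockS ?E //= -[k]/(k.+1.-1) -E.
Qed.

Lemma last_block_C n : nth false (block n Lc) (blen n).-1 = false.
Proof.
elim: n => // n IH; have := blen_gt0 n; case E: (blen n) => [//|k] _.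
have -> : (blen n.+1).-1 = blen n * 3 + k by rewrite blenS; lia.
by rewrite nth_blockS ?E //= -[k]/(k.+1.-1) -E.
Qed.

(** All three letters have an image starting with a. *)
Lemma seqA_recur m j i : i < blen m -> seqA (blen m.+1 * j + i) = seqA i.
Proof.
move=> ilt; have e x : nth false (block m.+1 x) i = nth false (block m La) i.
  by have := @nth_blockS m x 0 i isT ilt; rewrite muln0 add0n => ->; case: x.
have := @seqA_fixword m.+1 0 i; have := @seqA_fixword m.+1 j i.
rewrite muln0 add0n !e blenS => -> ; last lia.
by move=> ->; last lia.
Qed.

(** The second sub-block of A is A, that of B and of C is B; so separating A from B at one level
    separates A from both at the next. *)
Lemma block_A_neq n : exists2 i, i < blen n &
  nth false (block n La) i != nth false (block n Lb) i /\
  nth false (block n La) i != nth false (block n Lc) i.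
Proof.
elim: n => [|n [i ilt [ne _]]]; first by exists 2.
exists (blen n * 1 + i); first by rewrite blenS; lia.
by rewrite !nth_blockS //.
Qed.

(* The words 1000 and aa locate the block boundaries: each occurs only at the
   start of a block A. *)
Lemma seqA_recognizable m p :
  (forall i, i < blen m -> seqA (p + i) = seqA i) -> blen m %| p.
Proof.
elim: m => [|m IH] eqA.
  have lt5 : p %% 5 < 5 by rewrite ltn_mod.
  have e i : p + i = blen 0 * (p %/ 5) + (p %% 5 + i).
    by rewrite {1}(divn_eq p 5) /blen expn0 muln1; lia.
  have e' i : p + i = blen 0 * (p %/ 5).+1 + (p %% 5 + i - 5) \/
      p %% 5 + i < 5 by rewrite {1}(divn_eq p 5) /blen expn0 muln1; lia.
  rewrite /blen expn0 muln1 /dvdn.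
  (* The word 1000 meets at most two consecutive blocks of length 5, which leaves finitely many
     offsets and pairs of letters to check. *)
  have letter i : i < 4 -> seqA i = nth false (block 0 (fixword (p %/ 5)) ++
      block 0 (fixword (p %/ 5).+1)) (p %% 5 + i).
    move=> i4; rewrite -eqA; last by rewrite /blen; lia.
    rewrite nth_cat size_block; case: (ltnP _ (blen 0)) => hi.
      by rewrite e seqA_fixword.
    case: (e' i) => [->|]; last by move: hi; rewrite /blen; lia.
    by rewrite seqA_fixword //; move: lt5; rewrite /blen; lia.
  move: (letter 0 isT) (letter 1 isT) (letter 2 isT) (letter 3 isT).
  by case: (p %% 5) lt5 => [|[|[|[|[|//]]]]] //= _;
    case: (fixword _); case: (fixword _).
have /dvdnP[u pu] : blen m %| p.
  by apply: IH => i ilt; apply: eqA; rewrite blenS; lia.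
(* The two blocks of level [m] read from [p] on agree with the first two of A, which are both
   [block m La]. *)
have e t : t < 2 -> fixword (u + t) = La.
  move=> t2; have [i ilt [nb nc]] := block_A_neq m.
  have same k : k < blen m -> nth false (block m (fixword (u + t))) k =
      nth false (block m La) k.
    move=> klt; rewrite -seqA_fixword // (_ : _ + k = p + (blen m * t + k)).
      rewrite eqA ?seqA_fixword //; last by rewrite blenS; nia.
      by case: t t2 => [|[|]].
    by rewrite pu; lia.
  case: (fixword _) (same _ ilt) => // e1.
    by rewrite e1 eqxx in nb.
  by rewrite e1 eqxx in nc.
have := e 0 isT; have := e 1 isT; rewrite addn0.
rewrite pu blenS dvdn_pmul2r ?blen_gt0 // /dvdn.
have lt4 : u %% 4 < 4 by rewrite ltn_mod.
rewrite (divn_eq u 4) mulnC.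
case: (u %% 4) lt4 => [|[|[|[|//]]]] _; first by rewrite addn0 modnMr.
- by rewrite -(addnA _ 1 1) !fixwordS //; case: (fixword _).
- by rewrite -(addnA _ 2 1) !fixwordS //; case: (fixword _).
- by rewrite (@fixwordS _ 3) //; case: (fixword (u %/ 4)).
Qed.

(** A period [k] would shift a late copy of A_(k+1) by [k]; recognizability then makes [blen k]
    divide [k], although [k < blen k]. *)
Lemma seqA_not_eventually_periodic n k : 0 < k ->
  (forall i, n <= i -> seqA (i + k) = seqA i) -> False.
Proof.
move=> k0 per; suff : blen k %| k.
  by move/(dvdn_leq k0); rewrite leqNgt ltn_blen.
have dvd1 : blen k %| blen k.+1 * n.
  by apply: seqA_recognizable => i ilt; rewrite seqA_recur.
have dvd2 : blen k %| blen k.+1 * n + k.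
  apply: seqA_recognizable => i ilt; rewrite addnAC per ?seqA_recur //.
  have := blen_gt0 k.+1; nia.
by rewrite (dvdn_addr _ dvd1) in dvd2.
Qed.

(* Away from the last letter, B and C agree, so a position distinguishing two
   blocks of level [m.+1] lies in their second sub-block, and the third ones
   are B and C. *)
Lemma seqA_branch m p q :
  p = q %[mod blen m.+1] -> ~~ (blen m %| p.+1) -> seqA p != seqA q ->
  blen m <= p %% blen m.+1 < 2 * blen m /\
  seqA (p + (3 * blen m - (p %% blen m.+1).+1)) !=
    seqA (q + (3 * blen m - (p %% blen m.+1).+1)).
Proof.
have L0 := blen_gt0 m; have LS := blenS m.
move=> epq; have := divn_eq q (blen m.+1); have := divn_eq p (blen m.+1).
have : p %% blen m.+1 < blen m.+1 by rewrite ltn_mod blen_gt0.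
rewrite -epq; move: (p %% _) (p %/ _) (q %/ _) => t u v tlt -> -> {epq p q}.
rewrite ![_ * blen m.+1]mulnC !seqA_fixword // => nd.
have tE := divn_eq t (blen m); have ilt : t %% blen m < blen m by rewrite ltn_mod.
have r4 : t %/ blen m < 4 by rewrite ltn_divLR // -blenS.
have inl : (t %% blen m).+1 != blen m.
  apply: contraNneq nd => e; rewrite -addnS dvdn_addr; last first.
    by rewrite dvdn_mulr ?dvdn_blen.
  by rewrite tE -addnS e -mulSnr dvdn_mull.
have bc := block_BC inl.
rewrite {1 2}tE [_ * blen m]mulnC !nth_blockS // => ne.
have r1 : t %/ blen m = 1 by move: ne; case: (t %/ _) r4 => [|[|[|[|]]]] // _;
  case: (fixword u); case: (fixword v); rewrite /= ?bc ?eqxx.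
have ht : blen m <= t < 2 * blen m by move: tE ilt; rewrite r1; lia.
split=> //; rewrite -!addnA.
(* The shift leads to the last letter of the third sub-block, which is 1 in B and 0 in C. *)
have -> : t + (3 * blen m - t.+1) = blen m * 2 + (blen m).-1 by lia.
rewrite !seqA_fixword; try lia.
rewrite !nth_blockS //; try lia.
by move: ne; rewrite r1; case: (fixword u); case: (fixword v);
  rewrite /= ?bc ?eqxx ?last_block_B ?last_block_C.
Qed.

(* Base 4 digits: those of [u] followed by [n] digits 1. *)
Fixpoint append_ones (u n : nat) : nat :=
  if n is n'.+1 then 4 * append_ones u n' + 1 else u.

(** At index 1 the images of a and b contain a and b themselves, whereas that of c contains b. *)
Lemma fixword_append_ones u n : fixword u <> Lc ->
  fixword (append_ones u n) = fixword u.
Proof.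
move=> uc; elim: n => //= n IH; rewrite fixwordS // IH.
by case: (fixword u) uc.
Qed.

Lemma append_onesD u m n :
  append_ones u (m + n) = 4 ^ m * append_ones u n + append_ones 0 m.
Proof. by elim: m => [|m IH]; rewrite ?mul1n ?addn0 //= IH expnS; lia. Qed.

(** As [blen m = 5 * 4 ^ m], only the last [m] base 4 digits matter. *)
Lemma append_ones_modn u m n : m <= n ->
  blen 0 * append_ones u n = blen 0 * append_ones 0 m %[mod blen m].
Proof.
have e : blen 0 * 4 ^ m = blen m by rewrite /blen expn0 muln1.
by move=> /subnKC <-; rewrite append_onesD mulnDr mulnA e mulnC modnMDl.
Qed.

(** Letters 0 and 2 of the fixed word are a and b, and their blocks 10001 and 10101 differ at index
    2. *)
Lemma seqA_append_ones0 n : seqA (blen 0 * append_ones 0 n + 2) = false.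
Proof. by rewrite seqA_fixword // fixword_append_ones. Qed.

Lemma seqA_append_ones2 n : seqA (blen 0 * append_ones 2 n + 2).
Proof. by rewrite seqA_fixword // fixword_append_ones. Qed.

End Substitution.

(** * Epsilon-delta forms of continuity and of omega-limits *)

Section RealTopology.
Context {R : realType}.
Implicit Types (f : R -> R) (A : set R) (d e x y : R).

Lemma within_continuous_distP f A : {within A, continuous f} <->
  forall x, A x -> forall e, 0 < e ->
    exists2 d, 0 < d & forall y, A y -> `|y - x| < d -> `|f y - f x| < e.
Proof.
split=> [/subspace_continuousP fc x Ax e e0|fc].
  have /cvgrPdist_lt/(_ e e0) := fc x Ax.
  rewrite near_withinE => /nbhs_ballP[d /= d0 H]; exists d => // y Ay yx.
  by rewrite distrC; apply: H => //; rewrite /ball /= distrC.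
apply/subspace_continuousP => x Ax; apply/cvgrPdist_lt => e e0.
have [d d0 H] := fc x Ax e e0; rewrite near_withinE; apply/nbhs_ballP.
exists d => // y; rewrite /ball /= => yx Ay.
by rewrite distrC; apply: H => //; rewrite distrC.
Qed.

Lemma near_forall_ltn (P : nat -> R -> Prop) x (n : nat) :
  (forall i, exists2 d, 0 < d & forall y, `|y - x| < d -> P i y) ->
  exists2 d, 0 < d & forall y, `|y - x| < d -> forall i, (i < n)%N -> P i y.
Proof.
move=> H; elim: n => [|n [d d0 IH]]; first by exists 1.
have [e e0 He] := H n; exists (Num.min d e); first by rewrite lt_min d0.
move=> y; rewrite lt_min => /andP[yd ye] i.
by rewrite ltnS leq_eqVlt => /orP[/eqP ->|]; [exact: He|exact: IH].
Qed.

Lemma omega_limitP f x y : omega_limit f x y <->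
  forall e, 0 < e -> forall N : nat, exists2 n, (N <= n)%N & `|iter n f x - y| < e.
Proof.
split=> [H e e0 N|H A B].
  have [] := H [set iter n f x | n in [set n | (N <= n)%N]] (ball y e).
  - by exists N => // n /= Nn; exists n.
  - exact: nbhsx_ballx.
  by move=> _ [[n Nn <-]]; rewrite /ball /= distrC => ?; exists n.
case=> N _ NA /nbhs_ballP[e e0 eB]; have [n Nn nx] := H e e0 N.
by exists (iter n f x); split; [exact: NA|apply: eB; rewrite /ball /= distrC].
Qed.

Lemma same_side x y z : z != x -> `|y - z| < `|z - x| -> (x < y) = (x < z).
Proof.
have [xz|zx|->] // := ltgtP x z.
  by rewrite [`|z - x|]gtr0_norm ?subr_gt0 // ltr_norml => _ ?; lra.
rewrite [`|z - x|]ltr0_norm ?subr_lt0 // ltr_norml => _ ?.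
by apply/negbTE; rewrite -leNgt; lra.
Qed.

(** The end points are unordered because iterates of the map may reverse them. *)
Definition between (a b x : R) := (a <= x <= b) || (b <= x <= a).

Lemma betweenP a b x : reflect (a <= x <= b \/ b <= x <= a) (between a b x).
Proof. exact: orP. Qed.

End RealTopology.

(** * Monotone branches and itineraries of a unimodal map *)

Section UnimodalMap.
Context {R : realType} {f : R -> R} {c : R} (hf : unimodal f c).
Implicit Types (a b d e x y z : R) (s : nat -> bool).

Lemma unimodal_itv x : 0 <= x <= 1 -> 0 <= f x <= 1.
Proof. by have := @unimodal_maps _ _ _ hf x; rewrite /= !in_itv. Qed.

Lemma unimodal_iter_itv n x : 0 <= x <= 1 -> 0 <= iter n f x <= 1.
Proof. by move=> xI; elim: n => //= n; exact: unimodal_itv. Qed.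

Lemma turning_itv : 0 <= c <= 1.
Proof. by have := unimodal_turning hf; lra. Qed.

Lemma unimodal_iter_cont n x : 0 <= x <= 1 -> forall e, 0 < e ->
  exists2 d, 0 < d & forall y, `|y - x| < d -> 0 <= y <= 1 ->
    `|iter n f y - iter n f x| < e.
Proof.
move=> xI; elim: n => [|n IH] e e0 /=; first by exists e.
have /within_continuous_distP/(_ (iter n f x)) := unimodal_cont hf.
rewrite /= in_itv /= unimodal_iter_itv // => /(_ isT e e0)[d d0 H].
have [d' d'0 H'] := IH d d0; exists d' => // y yx yI.
by apply: H (H' _ yx yI); rewrite in_itv /= unimodal_iter_itv.
Qed.

Lemma unimodal_iters_cont N x e : 0 <= x <= 1 -> 0 < e ->
  exists2 d, 0 < d & forall y, `|y - x| < d -> 0 <= y <= 1 ->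
    forall n, (n <= N)%N -> `|iter n f y - iter n f x| < e.
Proof.
move=> xI e0.
have [n|d d0 H] := @near_forall_ltn _
    (fun n y => 0 <= y <= 1 -> `|iter n f y - iter n f x| < e) x N.+1.
  exact: unimodal_iter_cont.
by exists d => // y yx yI n nN; exact: H.
Qed.

(** Both branches contain [c], so lying on both of them means being [c]. *)
Definition weak_side (i : bool) x := if i then c <= x else x <= c.

Lemma weak_side_lt i x y : 0 <= x <= 1 -> 0 <= y <= 1 ->
  weak_side i x -> weak_side i y -> x < y -> if i then f y < f x else f x < f y.
Proof.
move=> xI yI; case: i => /= cx cy xy.
  by apply: (unimodal_decr hf) => //; rewrite in_itv /=; lra.
by apply: (unimodal_incr hf) => //; rewrite in_itv /=; lra.
Qed.

Lemma weak_side_le i x y : 0 <= x <= 1 -> 0 <= y <= 1 ->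
  weak_side i x -> weak_side i y -> x <= y ->
  if i then f y <= f x else f x <= f y.
Proof.
move=> xI yI ix iy; rewrite le_eqVlt => /orP[/eqP ->|xy]; first by case: i {ix iy}.
by have := weak_side_lt xI yI ix iy xy; case: i {ix iy}; exact: ltW.
Qed.

Lemma weak_side_inj i x y : 0 <= x <= 1 -> 0 <= y <= 1 ->
  weak_side i x -> weak_side i y -> f x = f y -> x = y.
Proof.
move=> xI yI ix iy fxy; apply/eqP; rewrite eq_le !leNgt; apply/andP; split.
  by apply/negP => /(weak_side_lt yI xI iy ix); rewrite fxy ltxx; case: ifP.
by apply/negP => /(weak_side_lt xI yI ix iy); rewrite fxy ltxx; case: ifP.
Qed.

Lemma unimodal_lt_turning x : 0 <= x <= 1 -> x != c -> f x < f c.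
Proof.
move=> xI /eqP xc; have cI := turning_itv; have [lt|lt|//] := ltgtP x c.
- by apply: (unimodal_incr hf) => //; rewrite in_itv /=; lra.
- by apply: (unimodal_decr hf) => //; rewrite in_itv /=; lra.
Qed.

Lemma weak_side_between i a b x :
  weak_side i a -> weak_side i b -> between a b x -> weak_side i x.
Proof. by case: i => /= ia ib /betweenP[]; lra. Qed.

Lemma between_itv a b x :
  0 <= a <= 1 -> 0 <= b <= 1 -> between a b x -> 0 <= x <= 1.
Proof. by move=> aI bI /betweenP[]; lra. Qed.

Lemma unimodal_between i a b x : 0 <= a <= 1 -> 0 <= b <= 1 ->
  weak_side i a -> weak_side i b -> between a b x -> between (f a) (f b) (f x).
Proof.
move=> aI bI ia ib abx; have xI := between_itv aI bI abx.
have ix := weak_side_between ia ib abx; apply/betweenP.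
case/betweenP: abx => /andP[l r].
  move: (weak_side_le aI xI ia ix l) (weak_side_le xI bI ix ib r).
  by case: i {ia ib ix} => -> ->; [right|left].
move: (weak_side_le bI xI ib ix l) (weak_side_le xI aI ix ia r).
by case: i {ia ib ix} => -> ->; [left|right].
Qed.

(** Each branch is an interval on which [f] is monotone, so betweenness passes from one time to the
    next. *)
Lemma iter_between s n a b x : 0 <= a <= 1 -> 0 <= b <= 1 ->
  (forall i, (i < n)%N ->
    weak_side (s i) (iter i f a) /\ weak_side (s i) (iter i f b)) ->
  between a b x -> between (iter n f a) (iter n f b) (iter n f x).
Proof.
move=> aI bI; elim: n => //= n IH H abx; have [sa sb] := H n (ltnSn n).
apply: (unimodal_between _ _ sa sb); rewrite ?unimodal_iter_itv //.
by apply: IH => // i /ltnW; exact: H.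
Qed.

Lemma iter_inj s n x y : 0 <= x <= 1 -> 0 <= y <= 1 ->
  (forall i, (i < n)%N ->
    weak_side (s i) (iter i f x) /\ weak_side (s i) (iter i f y)) ->
  iter n f x = iter n f y -> x = y.
Proof.
move=> xI yI; elim: n => //= n IH H e; have [sx sy] := H n (ltnSn n).
apply: IH => [i /ltnW|]; first exact: H.
by apply: weak_side_inj sx sy e; exact: unimodal_iter_itv.
Qed.

Lemma itv_length_le (J : set R) a b : J !=set0 ->
  (forall x, J x -> between a b x) -> itv_length J <= `|b - a|.
Proof.
move=> J0 H; rewrite /itv_length.
have : sup J <= Num.max a b.
  apply: ge_sup => // x /H/betweenP xab; rewrite le_max; lra.
have : Num.min a b <= inf J.
  apply: lb_le_inf => // x /H/betweenP xab; rewrite ge_min; lra.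
have [ab|ba] := leP a b.
  rewrite ger0_norm ?subr_ge0 //; lra.
rewrite ltr0_norm ?subr_lt0 //; lra.
Qed.

(* The images of [a, b] are intervals of length bounded below, so two of them
   share two points [p <> q].  The itineraries of these two images are those
   of [p] and [q]; where they differ, [p] and [q] would both be sent to [c]. *)
Lemma eventually_periodic_itinerary s a b : 0 <= a <= 1 -> 0 <= b <= 1 ->
  a < b ->
  (forall i, weak_side (s i) (iter i f a) /\ weak_side (s i) (iter i f b)) ->
  exists n k, (0 < k)%N /\ forall i, (n <= i)%N -> s (i + k)%N = s i.
Proof.
move=> aI bI ab sab.
have [|d d0 Hd] := unimodal_contraction hf (eps := (b - a) / 2).
  by rewrite divr_gt0 ?subr_gt0.
have long n : (0 < n)%N -> d < `|iter n f b - iter n f a|.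
  move=> n0; have ab0 : `[a, b]%classic !=set0.
    by exists a; rewrite /= in_itv /= lexx ltW.
  apply: lt_le_trans (Hd `[a, b]%classic _ _ _ n n0) _.
  - exact: interval_is_interval.
  - by move=> x; rewrite /= !in_itv /=; lra.
  - rewrite /itv_length sup_itv ?inf_itv ?bnd_simp ?ltW //.
    have : 0 < b - a by rewrite subr_gt0.
    lra.
  apply: itv_length_le => [|_ [x + <-]].
    by exists (iter n f a), a => //=; rewrite in_itv /= lexx ltW.
  rewrite /= in_itv /= => xab.
  by apply: (iter_between (s := s)) => //; apply/betweenP; left.
(* With mesh [1 / K] and [2 / K < d], an interval in [0,1] longer than [d] contains two consecutive
   grid points. *)
pose K := (Num.truncn (2 / d)).+1.
have K0 : 0 < K%:R :> R by rewrite ltr0n.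
have Kd : 2 / K%:R < d.
  by rewrite ltr_pdivrMr // mulrC -ltr_pdivrMr // truncnS_gt.
pose p (t : nat) : R := t.+1%:R / K%:R.
have grid n : exists t : 'I_K.+1,
    between (iter n.+1 f a) (iter n.+1 f b) (p t) /\
    between (iter n.+1 f a) (iter n.+1 f b) (p t.+1).
  move: (long n.+1 isT) (unimodal_iter_itv n.+1 aI) (unimodal_iter_itv n.+1 bI).
  move: (iter n.+1 f a) (iter n.+1 f b) => a' b' dab aI' bI'.
  pose lo := Num.min a' b'.
  have lo0 : 0 <= lo * K%:R.
    rewrite mulr_ge0 ?ler0n // /lo le_min.
    by case/andP: aI' => -> _; case/andP: bI'.
  have /andP[tlo tlt] := truncn_itv lo0.
  set t := Num.truncn _ in tlo tlt.
  have lo1 : lo <= 1 by rewrite /lo ge_min; case/andP: aI' => _ ->.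
  have tK : (t < K.+1)%N.
    rewrite ltnS -(ler_nat R) (le_trans tlo) // -[leRHS]mul1r ler_wpM2r //.
  exists (Ordinal tK); rewrite /p /=.
  have h1 : lo <= t.+1%:R / K%:R by rewrite ler_pdivlMr // ltW.
  have h2 : t.+1%:R / K%:R <= t.+2%:R / K%:R :> R.
    by rewrite ler_pM2r ?invr_gt0 // ler_nat.
  have h3 : t.+2%:R / K%:R <= lo + 2 / K%:R.
    have -> : t.+2%:R = t%:R + 2 :> R by rewrite -natrD addn2.
    by rewrite mulrDl lerD2r ler_pdivrMr.
  move: h1 h2 h3 dab; rewrite /lo /between; set u := _ / _; set v := _ / _.
  case: (leP a' b') => l h1 h2 h3; [rewrite ger0_norm ?subr_ge0 //|
    rewrite ltr0_norm ?subr_lt0 //] => h4; split; lra.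
have [g Hg] := choice grid.
(* Pigeonhole: [K + 2] times and only [K + 1] pairs of grid points. *)
have [i [j [ij gij]]] : exists i j : 'I_K.+2, (i < j)%N /\ g i = g j.
  have : ~~ injectiveb (fun i : 'I_K.+2 => g i).
    by apply/negP => /injectiveP/leq_card; rewrite !card_ord ltnn.
  rewrite /injectiveb; move=> /injectivePn[i [j ij e]].
  have [l|l|/val_inj e'] := ltngtP i j.
  - by exists i, j.
  - by exists j, i.
  - by rewrite e' eqxx in ij.
have pq : p (g i) <> p (g i).+1.
  move/(mulIf (invr_neq0 (lt0r_neq0 K0)))/eqP.
  by rewrite eqr_nat eqSS eqn_leq ltnn andbF.
have sh n k x : between (iter n.+1 f a) (iter n.+1 f b) x ->
    weak_side (s (n.+1 + k)%N) (iter k f x).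
  move=> abx.
  have [sa sb] := sab (n.+1 + k)%N.
  rewrite [(n.+1 + k)%N]addnC !iterD -[(k + _)%N]addnC in sa sb.
  apply: weak_side_between sa sb _.
  apply: (iter_between (s := fun i => s (n.+1 + i)%N)) abx => [||l _].
  - exact: unimodal_iter_itv.
  - exact: unimodal_iter_itv.
  - by rewrite -!iterD [(l + _)%N]addnC.
have [ip iq] := Hg i; have := Hg j; rewrite -gij => -[jp jq].
exists i.+1, (j - i)%N; split; first by rewrite subn_gt0.
move=> l /subnKC <-; rewrite addnAC addSn (subnKC (ltnW ij)).
move: (l - i.+1)%N => {}l; apply/eqP; apply/negPn/negP => ne.
have toc x : between (iter i.+1 f a) (iter i.+1 f b) x ->
    between (iter j.+1 f a) (iter j.+1 f b) x -> iter l f x = c.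
  move=> /(sh i l) + /(sh j l); move: ne; rewrite /weak_side.
  by case: (s _); case: (s _) => // _ *; apply/eqP; rewrite eq_le; apply/andP.
apply: pq; apply: (@iter_inj (fun k => s (i.+1 + k)%N) l).
- by apply: between_itv ip; exact: unimodal_iter_itv.
- by apply: between_itv iq; exact: unimodal_iter_itv.
- by move=> k _; split; exact: sh.
- by rewrite !toc.
Qed.

End UnimodalMap.

(** * Close returns of the turning point *)

Section KneadingSequenceA.
Context {R : realType} {f : R -> R} {c : R}.
Context (hf : unimodal f c) (hA : kneading_sequence f c seqA).
Implicit Types (d e x y z : R).

Let cI : 0 <= c <= 1 := turning_itv hf.

Let fcI n : 0 <= iter n f c <= 1.
Proof. exact: unimodal_iter_itv hf _ _ cI. Qed.

Lemma seqA_gtE i : seqA i = (c < iter i.+1 f c).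
Proof. by have := hA i; case: (seqA i) => [->|/ltW]; rewrite ?leNgt // => /negbTE. Qed.

Lemma iter_turning_neq n : (0 < n)%N -> iter n f c != c.
Proof.
case: n => // n _; have := hA n.
by case: (seqA n) => lt; [rewrite gt_eqF|rewrite lt_eqF].
Qed.

Lemma weak_side_seqA i : weak_side (c := c) (seqA i) (iter i.+1 f c).
Proof. by have := hA i; rewrite /weak_side; case: (seqA i) => /ltW. Qed.

(* Otherwise some [v < f c] lies between [f c] and points whose itineraries
   agree with A for arbitrarily long, so that [v] and [f c] have the same
   itinerary. *)
Lemma near_return e : 0 < e ->
  exists m, forall j, `|iter (blen m * j) f c - c| < e.
Proof.
move=> e0; have cb := unimodal_turning hf.
(* Shrinking [e] keeps [c - e'] and [c + e'] in [0,1]. *)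
pose e' := Num.min e (Num.min c (1 - c)).
have [e'0 e'e e'c e'1] : [/\ 0 < e', e' <= e, e' <= c & e' <= 1 - c].
  by rewrite /e' !lt_min !ge_min !lexx e0 subr_gt0 ?orbT; case/andP: cb => -> ->.
apply: contrapT => far.
have {}far m : exists j, e' <= `|iter (blen m * j) f c - c|.
  apply: contrapT => near; apply: far; exists m => j.
  by rewrite (lt_le_trans _ e'e) // ltNge; apply/negP => ?; apply: near; exists j.
have lI : 0 <= c - e' <= 1 by lra.
have rI : 0 <= c + e' <= 1 by lra.
(* By monotonicity on its branch, a point at distance at least [e'] from [c] has an image at most
   [v]. *)
pose v := Num.max (f (c - e')) (f (c + e')).
have vI : 0 <= v <= 1.
  have := unimodal_itv hf lI; have := unimodal_itv hf rI; rewrite /v.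
  by case: (leP (f (c - e')) (f (c + e'))) => _ /andP[? ?] /andP[? ?]; lra.
have vc : v < f c.
  by rewrite /v gt_max !(unimodal_lt_turning hf) //; apply/eqP => E; lra.
have yv m : exists j, iter (blen m * j).+1 f c <= v.
  have [j] := far m; exists j; move: (fcI (blen m * j)) => /= xI.
  rewrite /v le_max; set x := iter _ f c in xI p *.
  have [xc|xc] := leP x c.
    rewrite ler0_norm ?subr_le0 // in p.
    by rewrite (weak_side_le hf (i := false)) //=; lra.
  rewrite gtr0_norm ?subr_gt0 // in p.
  apply/orP; right.
  by apply: (weak_side_le hf (i := true) (x := c + e')) => //=; lra.
have [|n [k [k0 per]]] :=
    eventually_periodic_itinerary hf (s := seqA) vI (fcI 1) vc.
  move=> i; split; last by rewrite -iterSr; exact: weak_side_seqA.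
  (* A time divisible by [blen i.+1] starts a copy of the first [blen i] letters of A, and
     [i < blen i]. *)
  have [j yv'] := yv i.+1.
  have sy l : (l < blen i)%N ->
      weak_side (c := c) (seqA l) (iter l f (iter (blen i.+1 * j).+1 f c)).
    move=> li; rewrite -(@seqA_recur i j) // -iterD addnS addnC.
    exact: weak_side_seqA.
  have sc l : weak_side (c := c) (seqA l) (iter l f (iter 1 f c)).
    by rewrite -iterSr; exact: weak_side_seqA.
  apply: weak_side_between (sy i (ltn_blen i)) (sc i) _.
  apply: (iter_between hf (s := seqA)) => [||l li|]; [exact: fcI|exact: fcI| |].
    by split=> //; apply: sy; rewrite (ltn_trans li) ?ltn_blen.
  by apply/betweenP; left; rewrite yv' ltW.
exact: seqA_not_eventually_periodic k0 per.
Qed.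

(** No later iterate of [c] equals [c], so by continuity points near [c] share [blen m] letters with
    A, and recognizability applies. *)
Lemma near_turning_recognizable m : exists2 e, 0 < e &
  forall p, `|iter p f c - c| < e -> (blen m %| p)%N.
Proof.
have [i|d d0 H] := @near_forall_ltn _
    (fun i y => 0 <= y <= 1 -> (c < iter i.+1 f y) = seqA i) c (blen m).
  have ne := iter_turning_neq (ltn0Sn i).
  have n0 : 0 < `|iter i.+1 f c - c| by rewrite normr_gt0 subr_eq0.
  have [d d0 H] := unimodal_iter_cont hf i.+1 cI n0.
  by exists d => // y yc yI; rewrite seqA_gtE; exact: same_side ne (H y yc yI).
exists d => // p pc; apply: seqA_recognizable => i ilt.
by rewrite -(H _ pc i ilt (fcI p)) seqA_gtE -iterD addSn [(p + i)%N]addnC.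
Qed.

(** Let [r] complete [p] to a multiple of a large [blen]. Then time [p + r] is close to [c], hence
    so is [q + r] by continuity at [z], and both are divisible by [blen m]. *)
Lemma near_residue m z : 0 <= z <= 1 -> exists2 d, 0 < d &
  forall p q, `|iter p f c - z| < d -> `|iter q f c - z| < d ->
    p = q %[mod blen m].
Proof.
move=> zI; have [e e0 He] := near_turning_recognizable m.
have e3 : 0 < e / 3 by rewrite divr_gt0.
have [n Hn] := near_return e3.
have [d d0 Hd] := unimodal_iters_cont hf (blen (maxn m n)) zI e3.
(* Level [n] provides the close return, level [m] the residue. *)
exists d => // p q pz qz; set L := blen (maxn m n) in Hd.
have mL : (blen m %| L)%N by rewrite dvdn_blen ?leq_maxl.
pose r := (L - p %% L)%N; have rL : (r <= L)%N by rewrite leq_subr.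
have Lp : (L %| p + r)%N.
  have := ltn_mod p L; rewrite blen_gt0 => plt.
  rewrite {1}(divn_eq p L) /r -addnA subnKC; last exact: ltnW.
  by rewrite -mulSnr dvdn_mull.
have close : `|iter (r + q) f c - c| < e.
  have := Hd _ pz (fcI p) r rL; have := Hd _ qz (fcI q) r rL; rewrite -!iterD.
  have /dvdnP[j ->] : (blen n %| r + p)%N.
    by rewrite addnC (dvdn_trans _ Lp) // dvdn_blen ?leq_maxr.
  have := Hn j; rewrite mulnC.
  move: (iter (_ * _) f c) (iter (r + q) f c) (iter r f z) => u v w.
  rewrite !ltr_norml; lra.
have := He _ close; rewrite addnC => qr; have pr := dvdn_trans mL Lp.
apply/eqP; rewrite -(eqn_modDr r).
by move: pr qr; rewrite /dvdn => /eqP -> /eqP ->.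
Qed.

(** * The omega-limit set: recurrence, minimality and injectivity *)

Lemma omega_turning_itv x : omega_limit f c x -> 0 <= x <= 1.
Proof.
move=> /omega_limitP wx; apply/andP; split; rewrite leNgt; apply/negP => lt.
  have [|n _] := wx (- x) _ 0%N; first by rewrite oppr_gt0.
  by have := fcI n; rewrite ltr_norml; lra.
have [|n _] := wx (x - 1) _ 0%N; first by rewrite subr_gt0.
by have := fcI n; rewrite ltr_norml; lra.
Qed.

Lemma omega_turning_self : omega_limit f c c.
Proof.
apply/omega_limitP => e e0 N; have [m Hm] := near_return e0.
by exists (blen m * N)%N => //; rewrite leq_pmull // blen_gt0.
Qed.

Lemma omega_turning_map x : omega_limit f c x -> omega_limit f c (f x).
Proof.
move=> wx; have xI := omega_turning_itv wx; apply/omega_limitP => e e0 N.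
have [d d0 H] := unimodal_iter_cont hf 1 xI e0.
have [n Nn nx] := (omega_limitP _ _ _).1 wx d d0 N.
by exists n.+1; [exact: leqW|apply: H nx (fcI n)].
Qed.

Lemma omega_turning_iter n x : omega_limit f c x -> omega_limit f c (iter n f x).
Proof. by move=> wx; elim: n => //= n; exact: omega_turning_map. Qed.

Lemma omega_turning_approx x e N n : omega_limit f c x -> 0 < e ->
  exists2 p, (n <= p)%N &
    forall i, (i <= N)%N -> `|iter (p + i) f c - iter i f x| < e.
Proof.
move=> wx e0; have xI := omega_turning_itv wx.
have [d d0 H] := unimodal_iters_cont hf N xI e0.
have [p np px] := (omega_limitP _ _ _).1 wx d d0 n.
by exists p => // i iN; rewrite addnC iterD H.
Qed.

(** A visit of the orbit of [c] near [x] is followed within [blen m] steps by a close return to [c],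
    which [x] shadows. *)
Lemma omega_turning_return x e : omega_limit f c x -> 0 < e ->
  exists n, `|iter n f x - c| < e.
Proof.
move=> wx e0; have e2 : 0 < e / 2 by rewrite divr_gt0.
have [m Hm] := near_return e2; have L0 := blen_gt0 m.
have [p _ H] := omega_turning_approx (blen m) 0 wx e2.
pose r := (blen m - p %% blen m)%N; exists r.
have /dvdnP[j pj] : (blen m %| p + r)%N.
  have plt : (p %% blen m < blen m)%N by rewrite ltn_mod.
  rewrite {1}(divn_eq p (blen m)) /r -addnA subnKC; last exact: ltnW.
  by rewrite -mulSnr dvdn_mull.
have := H r (leq_subr _ _); have := Hm j; rewrite pj mulnC.
move: (iter _ f c) (iter r f x) => u w; rewrite !ltr_norml; lra.
Qed.

Lemma regularly_recurrent_turning : regularly_recurrent f c.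
Proof.
move=> U Uo Uc; have /nbhs_ballP[e e0 eU] := open_nbhs_nbhs (conj Uo Uc).
have [m Hm] := near_return e0; exists (blen m); first exact: blen_gt0.
by move=> j; apply: eU; rewrite /ball /= distrC.
Qed.

(** The orbit of [x] comes close enough to [c] to follow the orbit of [c] until it is near [y]. *)
Lemma minimal_omega_turning : minimal_on f (omega_limit f c).
Proof.
split=> [x|x wx y wy B /nbhs_ballP[e e0 eB]]; first exact: omega_turning_map.
have e2 : 0 < e / 2 by rewrite divr_gt0.
have [k _ ky] := (omega_limitP _ _ _).1 wy _ e2 0%N.
have [d d0 H] := unimodal_iter_cont hf k cI e2.
have [n nc] := omega_turning_return wx d0.
exists (iter (k + n) f x); split; first by exists (k + n)%N.
have := H _ nc (unimodal_iter_itv hf n (omega_turning_itv wx)).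
rewrite -iterD => h; apply: eB; rewrite /ball /=.
move: ky h; move: (iter _ f x) (iter _ f c) => u w; rewrite !ltr_norml; lra.
Qed.

(* If [x < c < y] had the same image [z], visits near [x] and near [y] would
   have the same residues and be distinguished by the kneading letter at these
   times; by [seqA_branch] at two levels, the itinerary of [z] would be
   ambiguous, that is [z] would hit [c], at two different times. *)
Lemma omega_turning_inj_lt x y : omega_limit f c x -> omega_limit f c y ->
  x < y -> f x <> f y.
Proof.
move=> wx wy xy fxy.
have xI := omega_turning_itv wx; have yI := omega_turning_itv wy.
have [xc cy] : x < c /\ c < y.
  split; rewrite ltNge; apply/negP => h.
    have := weak_side_lt hf (i := true) xI yI h (ltW (le_lt_trans h xy)) xy.
    by rewrite fxy ltxx.
  have := weak_side_lt hf (i := false) xI yI (ltW (lt_le_trans xy h)) h xy.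
  by rewrite fxy ltxx.
pose z := f x; have wz : omega_limit f c z := omega_turning_map wx.
have zI := omega_turning_itv wz.
(* The factor 1/2 makes the [e]-ball around [c] disjoint from those around [x] and [y]. *)
pose e := Num.min (c - x) (y - c) / 2.
have e0 : 0 < e by rewrite divr_gt0 // lt_min !subr_gt0 xc.
have ex : e <= (c - x) / 2 by rewrite ler_pM2r ?invr_gt0 // ge_min lexx.
have ey : e <= (y - c) / 2 by rewrite ler_pM2r ?invr_gt0 // ge_min lexx orbT.
have [m Hm] := near_return e0.
have [dx dx0 Hx] := near_residue m.+2 xI.
have [dz dz0 Hz] := near_residue m.+2 zI.
have [[//|p0] _ /(_ 0%N isT)] := omega_turning_approx 0 1 wx dx0.
rewrite [iter 0 f x]/= addn0 => p0x.
(* Times are [p.+1] and [q.+1] because [seqA p] is the letter of time [p.+1]. The residues agree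
   since both visits continue near [z]; [blen m] does not divide [p.+1] since that visit is far from
   [c]. *)
have visits d : 0 < d -> exists p q,
    [/\ `|iter p.+2 f c - z| < d, `|iter q.+2 f c - z| < d,
        p = p0 %[mod blen m.+2], q = p0 %[mod blen m.+2] &
        ~~ (blen m %| p.+1)%N && (seqA p != seqA q)].
  move=> d0; pose d' := Num.min d (Num.min e (Num.min dx dz)).
  have d'0 : 0 < d' by rewrite !lt_min d0 e0 dx0.
  have [[//|p] _ Hp] := omega_turning_approx 1 1 wx d'0.
  have [[//|q] _ Hq] := omega_turning_approx 1 1 wy d'0.
  have := Hp 0%N isT; have := Hp 1%N isT; have := Hq 0%N isT; have := Hq 1%N isT.
  rewrite !addn0 !addn1 /= -fxy -/z !lt_min.
  move=> /and4P[qd _ _ qz] /and4P[_ qe _ _] /and4P[pd _ _ pz] /and4P[_ pe px _].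
  exists p, q; have pp0 : p = p0 %[mod blen m.+2].
    have /eqP := Hx p.+1 p0.+1 px p0x.
    by rewrite -(addn1 p) -(addn1 p0) eqn_modDr => /eqP.
  have pq : p = q %[mod blen m.+2].
    have /eqP := Hz p.+2 q.+2 pz qz.
    by rewrite -(addn2 p) -(addn2 q) eqn_modDr => /eqP.
  split; rewrite // -?pq //.
  apply/andP; split.
    apply/negP => /dvdnP[j pj]; have := Hm j; rewrite mulnC -pj.
    by move: pe; rewrite /= !ltr_norml; lra.
  have -> : seqA q = true.
    by rewrite seqA_gtE; move: qe; rewrite /= ltr_norml; lra.
  have -> // : seqA p = false.
  by apply/negbTE; rewrite seqA_gtE -leNgt; move: pe; rewrite /= ltr_norml; lra.
(* If [iter t f z] were not [c], all visits close enough to [z] would have the same letter [t] steps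
   later. *)
have hit t : (forall d, 0 < d -> exists p q,
    [/\ `|iter p.+2 f c - z| < d, `|iter q.+2 f c - z| < d &
        seqA (p + t.+1)%N != seqA (q + t.+1)%N]) -> iter t f z = c.
  move=> H; apply/eqP/negPn/negP => zc.
  have n0 : 0 < `|iter t f z - c| by rewrite normr_gt0 subr_eq0.
  have [d d0 Hd] := unimodal_iter_cont hf t zI n0.
  have [p [q [pz qz]]] := H d d0; rewrite !seqA_gtE.
  have ht r : iter (r + t.+1).+1 f c = iter t f (iter r.+2 f c).
    by rewrite -iterD addnS -addSn addnC -addnS.
  rewrite !ht (same_side zc (Hd _ pz (fcI p.+2))).
  by rewrite (same_side zc (Hd _ qz (fcI q.+2))) eqxx.
(* This is the shift of [seqA_branch]; it depends only on the common residue, hence not on the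
   visits. *)
pose t k := (3 * blen k - (p0 %% blen k.+1).+1)%N.
have mods k p : (k < m.+2)%N -> p = p0 %[mod blen m.+2] ->
    p = p0 %[mod blen k.+1].
  move=> km e'; have d := dvdn_blen (km : (k.+1 <= m.+2)%N).
  by rewrite -(modn_dvdm p d) e' modn_dvdm.
have br1 p q : p = p0 %[mod blen m.+2] -> q = p0 %[mod blen m.+2] ->
    ~~ (blen m %| p.+1)%N -> seqA p != seqA q ->
    (blen m <= p0 %% blen m.+1 < 2 * blen m)%N /\
    seqA (p + t m)%N != seqA (q + t m)%N.
  move=> pp0 qp0; have pm := mods m p (leqnSn _) pp0.
  by rewrite /t -pm; apply: seqA_branch; rewrite pm (mods m q).
have br2 p q : p = p0 %[mod blen m.+2] -> q = p0 %[mod blen m.+2] ->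
    ~~ (blen m %| p.+1)%N -> seqA p != seqA q ->
    (blen m.+1 <= p0 %% blen m.+2 < 2 * blen m.+1)%N /\
    seqA (p + t m.+1)%N != seqA (q + t m.+1)%N.
  move=> pp0 qp0 np; rewrite /t -pp0; apply: seqA_branch; first by rewrite pp0.
  by apply: contraNN np; exact: dvdn_trans (dvdn_blen (leqnSn _)).
have [p [q [_ _ pp0 qp0 /andP[np ne]]]] := visits 1 ltr01.
have [h1 _] := br1 p q pp0 qp0 np ne; have [h2 _] := br2 p q pp0 qp0 np ne.
have L0 := blen_gt0 m; have LS := blenS m.
(* The bounds on the residues give [t m < 2 * blen m] and [4 * blen m <= t m.+1]. *)
have t1 : (0 < t m < t m.+1)%N.
  rewrite /t; move: (p0 %% blen m.+1)%N (p0 %% blen m.+2)%N h1 h2 L0 => i j.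
  by rewrite LS; move: (blen m); clear; lia.
have hit1 : iter (t m).-1 f z = c.
  apply: hit => d /visits[p' [q' [pz qz pp qp /andP[np' ne']]]].
  exists p', q'; split=> //; rewrite prednK; first by case: (br1 p' q').
  by case/andP: t1.
have hit2 : iter (t m.+1).-1 f z = c.
  apply: hit => d /visits[p' [q' [pz qz pp qp /andP[np' ne']]]].
  exists p', q'; split=> //; rewrite prednK; first by case: (br2 p' q').
  by case/andP: t1 => ?; exact: ltn_trans.
have dt : (0 < t m.+1 - t m)%N by rewrite subn_gt0; case/andP: t1.
(* Hitting [c] at two times would make [c] periodic. *)
have /eqP[] := iter_turning_neq dt.
rewrite -{1}hit1 -iterD -[RHS]hit2.
rewrite (_ : (_ + _ = (t m.+1).-1)%N) //.
by move: (t m) (t m.+1) t1; clear; lia.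
Qed.

Lemma omega_turning_inj x y : omega_limit f c x -> omega_limit f c y ->
  f x = f y -> x = y.
Proof.
move=> wx wy fxy; have [lt|lt|//] := ltgtP x y.
  by have := omega_turning_inj_lt wx wy lt.
by have := omega_turning_inj_lt wy wx lt; rewrite fxy.
Qed.

End KneadingSequenceA.

(** * Finite prefixes in an odometer *)

Section Odometer.
Context {alpha : nat -> nat}.

Lemma odometer_carry_prefix (x y : odometer_space alpha) k :
  (forall i, (i < k)%N -> x i = y i) ->
  forall n, (n <= k)%N -> odometer_carry x n = odometer_carry y n.
Proof.
move=> xy; elim=> //= n IH nk; rewrite IH ?xy //; exact: ltnW.
Qed.

(** Carries only move to the right, so the first [k] coordinates evolve on their own. *)
Lemma iter_odometer_prefix (x y : odometer_space alpha) k n :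
  (forall i, (i < k)%N -> x i = y i) ->
  forall i, (i < k)%N ->
    iter n (@odometer alpha) x i = iter n (@odometer alpha) y i.
Proof.
move=> xy; elim: n => //= n IH i ik; apply: val_inj => /=.
by rewrite (IH i ik) (odometer_carry_prefix IH) // ltnW.
Qed.

(** Cylinders are open, the factors being discrete. *)
Lemma within_continuous_prefix {R : realType} (A : set R)
    (h : R -> odometer_space alpha) (x : R) (k : nat) :
  {within A, continuous h} -> A x ->
  exists2 d : R, 0 < d & forall y : R, `|y - x| < d -> A y ->
    forall i, (i < k)%N -> h y i = h x i.
Proof.
move=> /subspace_continuousP hc Ax.
have [i|d d0 H] := @near_forall_ltn R (fun i y => A y -> h y i = h x i) x k.
  have hxi : nbhs (h x) (@proj nat _ i @^-1` [set h x i]).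
    by apply: proj_continuous; exact: discrete_set1.
  have /nbhs_ballP[d /= d0 H] : nbhs x [set y | A y -> h y i = h x i].
    exact: hc x Ax _ hxi.
  by exists d => // y yx Ay; apply: H => //; rewrite /ball /= distrC.
by exists d => // y yx Ay i ik; apply: H.
Qed.

End Odometer.

(** * The homeomorphism on the omega-limit set and the exclusion of odometers *)

Section OmegaLimit.
Context {R : realType} {f : R -> R} {c : R}.
Context (hf : unimodal f c) (hA : kneading_sequence f c seqA).
Implicit Types (d e x y z : R).

Lemma closed_omega_limit x : closed (omega_limit f x).
Proof.
move=> y cy; apply/omega_limitP => e e0 N.
have e2 : 0 < e / 2 by rewrite divr_gt0.
have [z [wz]] := cy _ (nbhsx_ballx y _ e2); rewrite /ball /= => zy.
have [n Nn nz] := (omega_limitP _ _ _).1 wz _ e2 N.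
exists n => //; move: zy nz; rewrite !ltr_norml; lra.
Qed.

Lemma compact_omega_turning : compact (omega_limit f c).
Proof.
apply: (subclosed_compact (@closed_omega_limit c)
  (@segment_compact R 0 1)) => x.
by move=> /(omega_turning_itv hf); rewrite /= in_itv.
Qed.

Lemma within_omega_continuous : {within omega_limit f c, continuous f}.
Proof.
apply: continuous_subspaceW (unimodal_cont hf) => x.
by move=> /(omega_turning_itv hf); rewrite /= in_itv.
Qed.

(* The image of the omega-limit set is compact and contains the orbit of
   [f c], which is dense by minimality. *)
Lemma omega_turning_surj y : omega_limit f c y ->
  exists2 x, omega_limit f c x & f x = y.
Proof.
move=> wy.
have cl : closed (f @` omega_limit f c).
  apply: compact_closed; first exact: Rhausdorff.
  exact: continuous_compact within_omega_continuous compact_omega_turning.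
have [_ min] := minimal_omega_turning hf hA.
have wc := omega_turning_self hf hA.
have wfc := omega_turning_map hf wc.
have sub : orbit_set f (f c) `<=` f @` omega_limit f c.
  move=> _ [n _ <-]; exists (iter n f c); first exact: (omega_turning_iter hf).
  by rewrite -iterS iterSr.
have [x wx fx] := cl y (closureS sub (min _ wfc _ wy)).
by exists x.
Qed.

Lemma homeomorphism_omega_turning :
  homeomorphism_on (omega_limit f c) (omega_limit f c) f.
Proof.
split; first exact: within_omega_continuous.
have ex y : exists x, omega_limit f c y -> omega_limit f c x /\ f x = y.
  have [wy|nwy] := pselect (omega_limit f c y); last by exists 0 => /nwy.
  by have [x wx fx] := omega_turning_surj wy; exists x.
have [g Hg] := choice ex.
exists g; split.
- exact: (omega_turning_map hf).
- by move=> y /Hg[].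
- move=> x; rewrite inE => wx; have wfx := omega_turning_map hf wx.
  by have [wg fg] := Hg _ wfx; apply: (omega_turning_inj hf hA).
- by move=> y; rewrite inE => /Hg[].
apply/within_continuous_distP => y wy e e0.
(* Continuity of the inverse by compactness: the image of [K] is closed and misses [y], so a ball
   around [y] avoids it. *)
pose K := omega_limit f c `&` ~` ball (g y) e.
have Kcl : closed K.
  by apply: closedI; [exact: (@closed_omega_limit c)|apply/open_closedC/ball_open].
have Kc : compact K.
  by apply: (subclosed_compact Kcl compact_omega_turning) => x [].
have fK : closed (f @` K).
  apply: compact_closed; first exact: Rhausdorff.
  apply: continuous_compact Kc.
  apply: continuous_subspaceW within_omega_continuous.
  by move=> x [].
have nKy : (~` (f @` K)) y.
  move=> [x [wx]] + fx; have [wg fg] := Hg _ wy.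
  rewrite (omega_turning_inj hf hA wx wg); first by apply; exact: ballxx.
  by rewrite fx fg.
have /nbhs_ballP[d d0 dK] := open_nbhs_nbhs (conj (closed_openC fK) nKy).
exists d => // y' wy' yy'; have [wg' fg'] := Hg _ wy'.
apply: contrapT => far; apply: (dK y'); first by rewrite /ball /= distrC.
by exists (g y') => //; split=> //; rewrite /ball /= distrC.
Qed.

(** Compactness of [0,1] gives the cluster point; since [n <= p n], the visits occur at arbitrarily
    late times. *)
Lemma omega_turning_cluster (p : nat -> nat) : (forall n, (n <= p n)%N) ->
  exists2 x, omega_limit f c x & forall e, 0 < e -> forall N : nat,
    exists2 n, (N <= n)%N & `|iter (p n) f c - x| < e.
Proof.
move=> np; have [|x [_ cx]] := segment_compact (a := 0 : R) (b := 1)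
    (F := (fun n => iter (p n) f c) @ \oo) _.
  exists 0%N => // n _ /=; rewrite in_itv /=.
  exact: (unimodal_iter_itv hf _ (turning_itv hf)).
have H e : 0 < e -> forall N : nat,
    exists2 n, (N <= n)%N & `|iter (p n) f c - x| < e.
  move=> e0 N; have [||_ [[n Nn <-]]] :=
    cx [set iter (p n) f c | n in [set n | (N <= n)%N]] (ball x e).
  - by exists N => // n /= Nn; exists n.
  - exact: nbhsx_ballx.
  by rewrite /ball /= distrC => ?; exists n.
exists x => //; apply/omega_limitP => e e0 N; have [n Nn nx] := H e e0 N.
by exists (p n) => //; exact: leq_trans (np n).
Qed.

(* The first [k] coordinates of the conjugate of [f^s c] depend only on [s]
   modulo some [blen m], so two limits of visits with the same residues modulo
   every [blen m] cannot be separated by an odometer. *)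
Lemma not_odometer_omega_turning (alpha : nat -> nat) :
  ~ conjugate_on f (omega_limit f c) (@odometer alpha)
      [set: odometer_space alpha].
Proof.
move=> [h [hc [g [_ _ hK _ _]]] hconj].
have wc := omega_turning_self hf hA.
have wn n : omega_limit f c (iter n f c) by exact: (omega_turning_iter hf).
have hiter x n : omega_limit f c x ->
    h (iter n f x) = iter n (@odometer alpha) (h x).
  move=> wx; elim: n => //= n IH; rewrite hconj ?IH //.
  exact: (omega_turning_iter hf).
have residue k : exists m, forall s t, s = t %[mod blen m] ->
    forall i, (i < k)%N -> h (iter s f c) i = h (iter t f c) i.
  have [d d0 Hd] := within_continuous_prefix k hc wc.
  have [m Hm] := near_return hf hA d0; exists m.
  have red s i : (i < k)%N ->
      h (iter s f c) i = h (iter (s %% blen m)%N f c) i.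
    rewrite {1}(divn_eq s (blen m)) addnC mulnC iterD !hiter //.
    move: i; apply: iter_odometer_prefix => i ik; rewrite -hiter //.
    by apply: Hd.
  by move=> s t st i ik; rewrite red // st -red.
pose p u n := (blen 0 * append_ones u n)%N.
have np u n : (n <= p u n)%N.
  suff : (n <= append_ones u n)%N by rewrite /p /blen; lia.
  by elim: n => //= n; lia.
have [x wx Hx] := omega_turning_cluster (np 0%N).
have [y wy Hy] := omega_turning_cluster (np 2%N).
have hxy : h x = h y.
  apply: functional_extensionality_dep => i.
  have [m Hm] := residue i.+1.
  have [dx dx0 Hdx] := within_continuous_prefix i.+1 hc wx.
  have [dy dy0 Hdy] := within_continuous_prefix i.+1 hc wy.
  have [n mn nx] := Hx dx dx0 m; have [n' mn' ny] := Hy dy dy0 m.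
  rewrite -(Hdx _ nx (wn _) i (ltnSn i)) -(Hdy _ ny (wn _) i (ltnSn i)).
  by apply: Hm; rewrite // /p !append_ones_modn.
have xy : x = y by rewrite -(hK x) ?inE // hxy hK ?inE.
have xI := omega_turning_itv hf wx.
have [e e0 He] := near_turning_recognizable hf hA 0.
have e2 : 0 < e / 2 by rewrite divr_gt0.
(* Three steps after the visits the letters at index 2 of the blocks put the two orbits on opposite
   sides of [c], yet within [e / 2] of a common point. So both are [e]-close to [c] at a time
   congruent to 3 modulo 5. *)
have [d d0 Hd] := unimodal_iter_cont hf 3 xI e2.
have [n _ nx] := Hx d d0 0%N; rewrite xy in Hd nx.
have [n' _ ny] := Hy d d0 0%N.
have cl u k : iter 3 f (iter (p u k) f c) = iter (p u k + 2).+1 f c.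
  by rewrite -iterD addnC -addnS.
have := Hd _ nx (unimodal_iter_itv hf _ (turning_itv hf)).
have := Hd _ ny (unimodal_iter_itv hf _ (turning_itv hf)).
have := seqA_append_ones0 n; have := seqA_append_ones2 n'.
rewrite -!/(p _ _) !(seqA_gtE hA) !cl => ly /negbT; rewrite -leNgt => lx hy hx.
have : (blen 0 %| (p 0 n + 2).+1)%N.
  by apply: He; move: lx ly hx hy; rewrite !ltr_norml; lra.
by rewrite -addnS dvdn_addr // dvdn_mulr.
Qed.

End OmegaLimit.

Theorem theorem7p7 (R : realType) (f : R -> R) (c : R)
    (hf : unimodal f c) (hA : kneading_sequence f c seqA) :
  [/\ regularly_recurrent f c,
      homeomorphism_on (omega_limit f c) (omega_limit f c) f,
      minimal_on f (omega_limit f c)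
    & ~ exists2 alpha : nat -> nat, (forall i : nat, (2 <= alpha i)%N) &
        conjugate_on f (omega_limit f c)
          (@odometer alpha) [set: odometer_space alpha]].
Proof.
split.
- exact: regularly_recurrent_turning hf hA.
- exact: homeomorphism_omega_turning hf hA.
- exact: minimal_omega_turning hf hA.
by move=> [alpha _]; exact: (not_odometer_omega_turning hf hA).
Qed.
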